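(* Let $R$ be a commutative ring with $1\neq 0$, let $Q$ be a special 2-absorbing primary ideal of $R$ and let $x\in R\setminus\sqrt{Q}$. Then: (1) $(Q:_R x)=(Q:_R x^n)$ for every $n\geq 2$; (2) $(\sqrt{Q}:_R x)=\sqrt{(Q:_R x)}$; (3) $(Q:_R x)$ is a special 2-absorbing primary ideal of $R$.
   Context: All rings are commutative with $1\neq 0$. A proper ideal $Q$ of $R$ is special 2-absorbing primary if whenever $a,b,c\in R$ satisfy $abc\in Q$, $ab\notin Q$ and $ac\notin\sqrt{Q}$, then $bc\in Q$. Here $\sqrt{I}$ is the radical of an ideal $I$, and $(I:_R x)=\{r\in R : rx\in I\}$. *)

(* Defs.v *)
From mathcomp Require Import all_boot all_order all_algebra.
From mathcomp Require Import boolp classical_sets.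

Set Implicit Arguments.
Unset Strict Implicit.
Unset Printing Implicit Defensive.

Import GRing.Theory.
Local Open Scope ring_scope.
Local Open Scope classical_set_scope.

(* Ideals are arbitrary subsets [set R], with membership in [bool] obtained
   classically, so the boolean predicates of ring_quotient apply to them
   without any decidability assumption. *)

Definition radical (R : comNzRingType) (I : set R) : set R :=
  [set r | exists2 n : nat, (0 < n)%N & r ^+ n \in I].

Definition colon (R : comNzRingType) (I : set R) (x : R) : set R :=
  [set r | r * x \in I].

(* [idealr_closed] includes properness, in the form [1 \notin Q]. *)
Definition special_2_absorbing_primary (R : comNzRingType) (Q : set R) : Prop :=
  idealr_closed [in Q] /\
  forall a b c : R, a * b * c \in Q -> a * b \notin Q ->
    a * c \notin radical Q -> b * c \in Q.

(* Main.v *)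
Require Import Defs.
From mathcomp Require Import all_boot all_order all_algebra.
From mathcomp Require Import boolp classical_sets.

(** The key case of the special 2-absorbing property is [(x, r, x ^+ n)] with
    [x] outside the radical.  The product of its outer terms is a power of
    [x], which also lies outside the radical; so if [r * x ^+ n.+1] is in [Q],
    then either [x * r] or [r * x ^+ n] is.  By descent on [n], powers of [x]
    can be cancelled down to a single factor ([cancel_power]), which is (1).

    Applied to [(r * x) ^+ n = r ^+ n * x ^+ n], the same cancellation shows
    that taking radicals commutes with taking the colon by [x], which is (2).
    For (3), the condition on [a * c] can then be read as
    [a * x * c \notin radical Q], and the property of [Q] at [(a * x, b, c)]
    gives [b * c \in Q], which is stronger than [b * c * x \in Q]. *)

Set Implicit Arguments.
Unset Strict Implicit.
Unset Printing Implicit Defensive.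

Import GRing.Theory.
Local Open Scope ring_scope.

Lemma mem_colon (R : comNzRingType) (Q : set R) (x r : R) :
  (r \in colon Q x) = (r * x \in Q).
Proof. by apply/idP/idP => [/set_mem|] // h; apply/mem_set. Qed.

Lemma radicalP (R : comNzRingType) (Q : set R) (r : R) :
  reflect (exists2 n : nat, (0 < n)%N & r ^+ n \in Q) (r \in radical Q).
Proof. by apply: (iffP idP) => [/set_mem|h] //; apply/mem_set. Qed.

Lemma idealr_closedMl (R : comNzRingType) (Q : set R) (a u : R) :
  idealr_closed [in Q] -> u \in Q -> a * u \in Q.
Proof. by case=> Q0 _ QD Qu; rewrite -[a * u]addr0; apply: QD. Qed.

Lemma radicalX (R : comNzRingType) (Q : set R) (x : R) (n : nat) :
  (0 < n)%N -> x ^+ n \in radical Q -> x \in radical Q.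
Proof.
move=> n_gt0 /radicalP[m m_gt0 Qxnm]; apply/radicalP.
by exists (n * m)%N; rewrite ?muln_gt0 ?n_gt0 // exprM.
Qed.

Lemma cancel_power (R : comNzRingType) (Q : set R) (x r : R) (n : nat) :
    special_2_absorbing_primary Q -> x \notin radical Q ->
  r * x ^+ n.+1 \in Q -> r * x \in Q.
Proof.
move=> [_ absQ] xNrad; elim: n => [|n IHn]; first by rewrite expr1.
move=> Qrx; apply: contraT => rxNQ; rewrite -(negPf rxNQ).
apply: IHn; apply: (absQ x); first by rewrite mulrAC -exprS mulrC.
- by rewrite mulrC.
- by rewrite -exprS; apply: contra xNrad; apply: radicalX.
Qed.

Lemma colonX (R : comNzRingType) (Q : set R) (x : R) (n : nat) :
    special_2_absorbing_primary Q -> x \notin radical Q -> (0 < n)%N ->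
  colon Q (x ^+ n) = colon Q x.
Proof.
case: n => // n hQ hx _; have [idQ _] := hQ.
apply/seteqP; split=> r; rewrite /colon /= => Qr.
  exact: cancel_power Qr.
by rewrite exprSr mulrCA; apply: idealr_closedMl.
Qed.

Lemma colon_radical (R : comNzRingType) (Q : set R) (x : R) :
    special_2_absorbing_primary Q -> x \notin radical Q ->
  colon (radical Q) x = radical (colon Q x).
Proof.
move=> hQ hx; apply/seteqP; split=> r.
  move=> /radicalP[n n_gt0 Qrxn]; exists n => //.
  by rewrite -(colonX hQ hx n_gt0) mem_colon -exprMn.
move=> [n n_gt0]; rewrite -(colonX hQ hx n_gt0) mem_colon -exprMn => Qrxn.
by apply/radicalP; exists n.
Qed.

Lemma idealr_closed_colon (R : comNzRingType) (Q : set R) (x : R) :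
  idealr_closed [in Q] -> x \notin Q -> idealr_closed [in colon Q x].
Proof.
move=> [Q0 _ QD] xNQ; split; rewrite ?mem_colon ?mul0r ?mul1r // => a u v.
by rewrite !mem_colon mulrDl -mulrA; apply: QD.
Qed.

Theorem theorem3p6 (R : comNzRingType) (Q : set R) (x : R)
    (hQ : special_2_absorbing_primary Q) (hx : x \notin radical Q) :
  [/\ (forall n : nat, (2 <= n)%N -> colon Q x = colon Q (x ^+ n)),
      colon (radical Q) x = radical (colon Q x)
    & special_2_absorbing_primary (colon Q x)].
Proof.
have [idQ absQ] := hQ.
split; [|exact: colon_radical|split].
- by move=> n /ltnW n_gt0; rewrite colonX.
- apply: idealr_closed_colon => //; apply: contra hx => Qx.
  by apply/radicalP; exists 1%N.
- move=> a b c; rewrite -colon_radical // !mem_colon => Qabcx abxNQ acxNrad.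
  rewrite mulrC; apply: idealr_closedMl => //.
  apply: (absQ (a * x)); last by rewrite mulrAC.
  + by rewrite (mulrAC a) (mulrAC _ x c).
  + by rewrite mulrAC.
Qed.
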